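(* Let $n$ be a positive integer and $\mathbf b=(b_1,\dots,b_n)\in\mathbb Z_{>0}^n$, not with $n=1=b_1$. The polytope $\mathfrak X_n(\mathbf b)$ is a linear projection of a relaxed bounded-size partition polytope: it is the image of the polytope $R_n(\mathbf b)\subset\mathbb R^{n\times S_n}$ under the linear map $(x_{ij})\mapsto\left(\sum_{j=1}^{S_n}j\cdot x_{ij}\right)_{i=1,\dots,n}$.
   Context: A $\mathbf b$-parking function is a list $(\beta_1,\dots,\beta_n)$ of positive integers whose nondecreasing rearrangement $\beta'_1\le\cdots\le\beta'_n$ satisfies $\beta'_i\le b_1+\cdots+b_i$ for all $i$. The $\mathbf b$-parking-function polytope $\mathfrak X_n(\mathbf b)\subset\mathbb R^n$ is the convex hull of all $\mathbf b$-parking functions. Write $S_0=0$ and $S_i=\sum_{j=1}^ib_j$. The bounded-size partition polytope (with lower bounds $\kappa_j$, $1\le j\le S_n$) is the set of $(x_{ij})\in\mathbb R^{n\times S_n}$ with $\sum_{j=1}^{S_n}x_{ij}=1$ for $1\le i\le n$, $\sum_{i=1}^nx_{ij}\ge\kappa_j$ for $1\le j\le S_n$, and $x_{ij}\ge0$; here $\kappa_j=\frac1{S_t-S_{t-1}}$ for $S_{t-1}<j\le S_t$, $t\in\{1,\dots,n\}$. Its relaxation, denoted here $R_n(\mathbf b)$, is obtained by replacing the constraints $\sum_{i=1}^nx_{ij}\ge\kappa_j$ by the sums of the first $S_k$ of them for $1\le k\le n$: it is the set of $(x_{ij})\in\mathbb R^{n\times S_n}$ with $\sum_{j=1}^{S_n}x_{ij}=1$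 for $1\le i\le n$; $\sum_{j=1}^{S_k}\sum_{i=1}^nx_{ij}\ge k$ for $1\le k\le n$; and $x_{ij}\ge0$ for $1\le i\le n$, $1\le j\le S_n$. *)

(* Defs.v *)
From HB Require Import structures.
From mathcomp Require Import all_boot all_order all_algebra.
From mathcomp Require Import boolp classical_sets reals convex.

Set Implicit Arguments.
Unset Strict Implicit.
Unset Printing Implicit Defensive.

Import Order.TTheory GRing.Theory Num.Theory.

Local Open Scope classical_set_scope.
Local Open Scope ring_scope.

Definition convex_hull (R : realType) (E : lmodType R) (A : set E) : set E :=
  smallest (fun C : set E => @convex_set R E C) A.

(* Indices are 0-based: [b i] is b_{i+1}, so [psum b k] is
   S_k = b_1 + ... + b_k. *)
Definition psum (n : nat) (b : 'I_n -> nat) (k : nat) : nat :=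
  (\sum_(i < n | (i < k)%N) b i)%N.

Definition parking_function (n : nat) (b : 'I_n -> nat) (beta : n.-tuple nat) :
    Prop :=
  all (fun x => 0 < x)%N beta /\
  forall i, (i < n)%N -> (nth 0 (sort leq beta) i <= psum b i.+1)%N.

Definition parking_polytope (R : realType) (n : nat) (b : 'I_n -> nat) :
    set 'rV[R]_n :=
  convex_hull [set \row_i (tnth beta i)%:R |
                 beta in [set beta | parking_function b beta]].

(* Columns are 0-based: column [j] carries x_{i,j+1}, so the columns
   1, ..., S_k are those with [j < psum b k]. *)
Definition relaxed_partition_polytope (R : realType) (n : nat)
    (b : 'I_n -> nat) : set 'M[R]_(n, psum b n) :=
  [set x | [/\ forall i, \sum_(j < psum b n) x i j = 1,
               forall k, (1 <= k <= n)%N ->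
                 k%:R <= \sum_(j < psum b n | (j < psum b k)%N)
                           \sum_(i < n) x i j
             & forall i j, 0 <= x i j]].

Arguments parking_polytope R {n} b.
Arguments relaxed_partition_polytope R {n} b.

Definition weighted_row_sum (R : realType) (n m : nat) (x : 'M[R]_(n, m)) :
    'rV[R]_n :=
  \row_i \sum_(j < m) j.+1%:R * x i j.

Fact weighted_row_sum_is_linear (R : realType) (n m : nat) :
  linear (@weighted_row_sum R n m).
Proof.
move=> a x y; apply/rowP => i; rewrite !mxE mulr_sumr -big_split /=.
by apply: eq_bigr => j _; rewrite !mxE mulrDr mulrCA.
Qed.

HB.instance Definition _ (R : realType) (n m : nat) :=
  GRing.isLinear.Build R 'M[R]_(n, m) 'rV[R]_n *:%R
    (@weighted_row_sum R n m) (@weighted_row_sum_is_linear R n m).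

(* Main.v *)
(* Parking functions are exactly the 0/1 points of the relaxed polytope, read
   through their assignment matrices, so it suffices that each point [x] of that
   polytope is a convex combination of integral ones. If [x] is not integral,
   group the columns into blocks between consecutive tight prefix constraints.
   Every row sum and every block sum of [x] is an integer, so a row or block
   with a non-integral entry has at least two. In the bipartite multigraph of
   rows and blocks, with the non-integral entries as edges, there is therefore
   a nonzero weighting of the edges that sums to 0 at every vertex; moving [x]
   both ways along it until a new constraint becomes tight writes [x] as a
   convex combination of points with more tight constraints. *)

Require Import Defs.
From mathcomp Require Import all_boot all_order all_algebra.
From mathcomp Require Import boolp classical_sets reals convex.
From mathcomp Require Import interval_inference.

Set Implicit Arguments.
Unset Strict Implicit.
Unset Printing Implicit Defensive.

Import Order.TTheory GRing.Theory Num.Theory.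

Local Open Scope classical_set_scope.
Local Open Scope ring_scope.

(** * Balanced edge weightings of bipartite multigraphs *)

(** Each nonempty fibre of [p] on [F] has at least two elements, and [#|F|] is the sum of the fibre
    sizes. *)
Lemma card_imset_fiber_ge2 (T P : finType) (F : {set T}) (p : T -> P) :
  {in F, forall e, exists e', [/\ e' \in F, e' != e & p e' = p e]} ->
  (#|(p @: F)%SET|.*2 <= #|F|)%N.
Proof.
move=> F2; rewrite -[#|F|]sum1_card (partition_big_imset p) /=.
rewrite -muln2 -sum_nat_const.
apply: leq_sum => y /imsetP[e eF ->].
have [e' [e'F ne pe]] := F2 e eF.
by rewrite (bigD1 e) ?eF ?eqxx //= (bigD1 e') //= e'F pe eqxx.
Qed.

(* A bipartite multigraph with edge set [F] and no vertex of degree 1 has at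
   least as many edges as vertices; its incidence matrix kills the vector
   (1, ..., 1, -1, ..., -1), so its rank is less than the number of edges. *)
Lemma balanced_vector (R : fieldType) (T P Q : finType) (F : {set T})
    (p : T -> P) (q : T -> Q) (e0 : T) :
  e0 \in F ->
  {in F, forall e, exists e', [/\ e' \in F, e' != e & p e' = p e]} ->
  {in F, forall e, exists e', [/\ e' \in F, e' != e & q e' = q e]} ->
  exists d : T -> R, [/\ exists e, d e != 0,
    forall e, e \notin F -> d e = 0,
    forall y, \sum_(e | p e == y) d e = 0
    & forall y, \sum_(e | q e == y) d e = 0].
Proof.
move=> e0F /card_imset_fiber_ge2 pF2 /card_imset_fiber_ge2 qF2.
set PF := (p @: F)%SET in pF2; set QF := (q @: F)%SET in qF2.
pose inc (S : finType) (B : {set S}) (f : T -> S) : 'M[R]_(#|F|, #|B|) :=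
  \matrix_(i, j) (f (enum_val i) == enum_val j)%:R.
(* An edge has exactly one endpoint on each side, so the rows of an incidence matrix sum to 1. *)
have inc1 (S : finType) (f : T -> S) :
    inc S (f @: F)%SET f *m const_mx 1 = const_mx 1 :> 'cV_#|F|.
  apply/colP => i; rewrite !mxE.
  transitivity (\sum_(y in (f @: F)%SET) (f (enum_val i) == y)%:R : R).
    by rewrite [RHS]big_enum_val; apply: eq_bigr => j _; rewrite !mxE mulr1.
  rewrite (bigD1 (f (enum_val i))) ?imset_f ?enum_valP //= eqxx big1 ?addr0 //.
  by move=> y /andP[_ /negPf]; rewrite eq_sym => ->.
pose A := row_mx (inc _ PF p) (inc _ QF q).
have Au : A *m col_mx (const_mx 1) (- const_mx 1) = 0 :> 'cV_#|F|.
  by rewrite mul_row_col mulmxN !inc1 subrr.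
have rkA : (\rank A < #|F|)%N.
  have le_cols : (#|PF| + #|QF| <= #|F|)%N.
    by rewrite -leq_double doubleD -[X in (_ <= X)%N]addnn leq_add.
  apply: leq_trans le_cols; rewrite ltn_neqAle rank_leq_col andbT.
  (* A left inverse of [A] would force the nonzero vector killed by [A] to vanish. *)
  apply/negP => /row_fullP[B BA].
  have : B *m (A *m col_mx (const_mx 1) (- const_mx 1)) = 0 :> 'cV_(_ + _).
    by rewrite Au mulmx0.
  rewrite mulmxA BA mul1mx => /matrixP.
  have i0 : 'I_#|PF| by apply: (enum_rank_in (imset_f p e0F) (p e0)).
  move/(_ (lshift _ i0) 0); rewrite col_mxEu !mxE => /eqP.
  by rewrite oner_eq0.
have : kermx A != 0 by rewrite kermx_eq0 /row_free neq_ltn rkA.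
case/rowV0Pn => v; rewrite sub_kermx mul_mx_row -row_mx0.
move=> /eqP/eq_row_mx[vp vq] v0.
(* The left kernel vector [v] weights the edges in [F]; [d] extends it by 0 to all of [T]. *)
pose d e := \sum_(i < #|F|) (enum_val i == e)%:R * v 0 i.
have sumd (S : finType) (f : T -> S) : v *m inc S (f @: F)%SET f = 0 ->
    forall y, \sum_(e | f e == y) d e = 0.
  move=> vf y; rewrite exchange_big /=.
  transitivity (\sum_(i < #|F|) v 0 i * (f (enum_val i) == y)%:R).
    apply: eq_bigr => i _; rewrite -mulr_suml mulrC; congr (_ * _).
    case: eqP => fy.
      rewrite (bigD1 (enum_val i)) /= ?eqxx ?fy // big1 ?addr0 //.
      by move=> e /andP[_ /negPf]; rewrite eq_sym => ->.
    by rewrite big1 // => e /eqP ey; case: eqP => // ie; rewrite ie in fy.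
  have [yF|yF] := boolP (y \in (f @: F)%SET).
    move/rowP/(_ (enum_rank_in yF y)): vf; rewrite !mxE => {2}<-.
    by apply: eq_bigr => i _; rewrite !mxE enum_rankK_in.
  rewrite big1 // => i _; case: eqP => [fy|]; last by rewrite mulr0.
  by rewrite -fy imset_f ?enum_valP in yF.
exists d; split; [| |exact: sumd|exact: sumd].
- have [i vi] : exists i, v 0 i != 0.
    apply/existsP; apply: contraR v0; rewrite negb_exists => /forallP v0.
    by apply/eqP/rowP => i; rewrite !mxE; apply/eqP; rewrite -[_ == _]negbK.
  exists (enum_val i); rewrite /d (bigD1 i) //= eqxx mul1r big1 ?addr0 //.
  by move=> j /negPf ji; rewrite (inj_eq enum_val_inj) ji mul0r.
- move=> e eF; rewrite /d big1 // => i _; case: eqP => [ie|]; last by rewrite mul0r.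
  by rewrite -ie enum_valP in eF.
Qed.

(** * Decomposing points of a polyhedron by moves to faces *)

Section Polyhedron.
Context (R : realFieldType) (V : lmodType R) (I : finType).
Variables (l : I -> V -> R) (a : I -> R).
Hypothesis linear_l : forall c x k d, l c (x + k *: d) = l c x + k * l c d.

Let slack x := [set c | l c x != a c]%SET.

(** Ratio test: [t] is the least ratio of slack to rate of decrease over the constraints that
    decrease along [d]. A minimising constraint becomes tight, and tight ones stay tight. *)
Lemma move_to_face x d : (forall c, a c <= l c x) ->
  (forall c, l c x = a c -> l c d = 0) -> (exists c, l c d < 0) ->
  exists t, [/\ 0 < t, forall c, a c <= l c (x + t *: d)
                & (#|slack (x + t *: d)| < #|slack x|)%N].
Proof.
move=> x_ge tight_d [c0 dc0].
have slack_gt0 c : l c d < 0 -> 0 < l c x - a c.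
  move=> dc; rewrite subr_gt0 lt_neqAle x_ge andbT eq_sym.
  by apply/eqP => /tight_d d0; rewrite d0 ltxx in dc.
case: (@arg_minP _ R _ c0 (fun c => l c d < 0)
  (fun c => (l c x - a c) / - l c d)) => // c dc c_min.
set t := (l c x - a c) / - l c d in c_min.
have t_gt0 : 0 < t by rewrite divr_gt0 ?slack_gt0 ?oppr_gt0.
exists t; split=> // [c'|].
  rewrite linear_l; have [dc'|dc'] := ltP (l c' d) 0; last first.
    by apply: (le_trans (x_ge c')); rewrite lerDl mulr_ge0 // ltW.
  have := c_min _ dc'; rewrite ler_pdivlMr ?oppr_gt0 // mulrN.
  by rewrite -subr_ge0 opprK addrAC subr_ge0.
apply/proper_card/properP; split.
  apply/fintype.subsetP => c'; rewrite !inE linear_l; apply: contraNN => /eqP tc.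
  by rewrite tc (tight_d _ tc) mulr0 addr0.
exists c; rewrite !inE.
  by apply: contraTneq dc => /tight_d ->; rewrite ltxx.
rewrite negbK linear_l /t invrN mulrN mulNr divfK ?(lt_eqF dc) //.
by rewrite opprB addrC subrK.
Qed.

(** Induction on the number of slack constraints, moving from [x] along [d] and along [- d]. [E] is
    for side conditions that such moves preserve, such as linear equations. *)
Lemma polyhedron_ind (E A : V -> Prop) :
  (forall x y (t : R), 0 <= t <= 1 -> A x -> A y -> A (t *: x + (1 - t) *: y)) ->
  (forall x, E x -> (forall c, a c <= l c x) -> A x \/
    exists d, [/\ forall k, E (x + k *: d),
      forall c, l c x = a c -> l c d = 0,
      exists c, l c d < 0 & exists c, 0 < l c d]) ->
  forall x, E x -> (forall c, a c <= l c x) -> A x.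
Proof.
move=> convA step x.
have [n] := ubnP #|slack x|; elim: n x => // n IHn x slack_x Ex x_ge.
have [//|[d [Ed tight_d neg_d pos_d]]] := step x Ex x_ge.
have l0 c : l c 0 = 0.
  by have /esym/(canRL (addKr _)) := linear_l c 0 1 0; rewrite scaler0 addr0 mul1r addNr.
have lN c : l c (- d) = - l c d.
  by rewrite -scaleN1r -[_ *: d]add0r linear_l l0 add0r mulN1r.
have [t [t_gt0 t_ge t_slack]] := move_to_face x_ge tight_d neg_d.
have [||s [s_gt0 s_ge s_slack]] := @move_to_face x (- d) x_ge.
- by move=> c /tight_d; rewrite lN => ->; rewrite oppr0.
- by case: pos_d => c; exists c; rewrite lN oppr_lt0.
have ts_gt0 : 0 < t + s by rewrite addr_gt0.
(* The weights make the displacements [t *: d] and [s *: - d] cancel. *)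
have -> : x = (s / (t + s)) *: (x + t *: d) + (1 - s / (t + s)) *: (x + s *: - d).
  have -> : 1 - s / (t + s) = t / (t + s).
    by rewrite -[X in X - _](divff (lt0r_neq0 ts_gt0)) -mulrBl addrK.
  rewrite !scalerDr addrACA -scalerDl -mulrDl [s + t]addrC.
  rewrite divff ?lt0r_neq0 // scale1r !scalerN !scalerA.
  by rewrite [s / _ * t]mulrAC [t / _ * s]mulrAC [s * t]mulrC subrr addr0.
apply: convA.
- by rewrite ler_pdivrMr // mul1r lerDr divr_ge0 // ltW.
- by apply: IHn => //; apply: leq_trans t_slack _.
- apply: IHn => //; first by apply: leq_trans s_slack _.
  by rewrite scalerN -scaleNr.
Qed.

End Polyhedron.

(** * Sorted lists, and sums with integral or zero total *)

(** The entries at most [B] of a sorted list form an initial segment. *)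
Lemma sorted_nth_leq (s : seq nat) (B i : nat) : sorted leq s -> (i < size s)%N ->
  (nth 0 s i <= B)%N = (i < count (fun x => x <= B)%N s)%N.
Proof.
elim: s i => // x s IHs i /= path_s; rewrite ltnS => i_lt.
have /allP x_min := order_path_min leq_trans path_s.
have [xB|Bx] := leqP x B.
  by case: i i_lt => [|i] i_lt; rewrite ?xB //= add1n ltnS IHs // (path_sorted path_s).
have -> : count (fun x => x <= B)%N s = 0%N.
  apply/eqP; rewrite -leqn0 leqNgt -has_count; apply/hasPn => y /x_min xy.
  by rewrite -ltnNge (leq_trans Bx).
rewrite ltn0; case: i i_lt => [|i] i_lt /=; first by rewrite leqNgt Bx.
by rewrite leqNgt (leq_trans Bx) // x_min // mem_nth.
Qed.

(** Were all other terms integral, [x e0] would be too. This excludes vertices of degree 1 among the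
    non-integral entries. *)
Lemma sum_int_other (R : archiNumDomainType) (T : finType) (B : pred T)
    (x : T -> R) (e0 : T) :
  \sum_(e | B e) x e \is a Num.int -> B e0 -> x e0 \isn't a Num.int ->
  exists e, [/\ x e \isn't a Num.int, e != e0 & B e].
Proof.
move=> sumZ Be0; apply: contraNP => no_e.
rewrite (bigD1 e0) //= rpredDr // in sumZ.
apply: rpred_sum => e /andP[Be ne].
by apply/negPn/negP => xe; apply: no_e; exists e.
Qed.

Lemma sum_eq0_lt0 (R : realDomainType) (T : finType) (B : pred T) (x : T -> R) e0 :
  \sum_(e | B e) x e = 0 -> B e0 -> x e0 != 0 -> exists e, x e < 0.
Proof.
move=> sum0 Be0; apply: contraNP => no_neg.
apply/eqP/(psumr_eq0P _ sum0) => // e _.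
by rewrite leNgt; apply/negP => xe; apply: no_neg; exists e.
Qed.

(** * Column blocks between tight prefix constraints *)

Lemma leq_psum n (b : 'I_n -> nat) : {homo psum b : k k' / (k <= k')%N}.
Proof.
move=> k k' kk'; rewrite /psum big_mkcond [leqRHS]big_mkcond leq_sum // => i _.
by case: ltnP => // ik; rewrite (leq_trans ik kk').
Qed.

Lemma sum_colE (R : nmodType) n m (P : pred 'I_m) (x : 'M[R]_(n, m)) :
  \sum_(j < m | P j) \sum_(i < n) x i j =
  \sum_(e : 'I_n * 'I_m | P e.2) x e.1 e.2.
Proof.
rewrite exchange_big (pair_big_dep predT (fun=> P) (fun i j => x i j)) /=.
exact: eq_bigl.
Qed.

Lemma sum_rowE (R : nmodType) n m (x : 'M[R]_(n, m)) i :
  \sum_(j < m) x i j = \sum_(e : 'I_n * 'I_m | e.1 == i) x e.1 e.2.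
Proof.
rewrite -[LHS](big_pred1_eq +%R i (fun i => \sum_(j < m) x i j)).
rewrite (pair_big_dep (pred1 i) (fun=> predT) (fun i j => x i j)) /=.
by apply: eq_bigl => e; rewrite andbT.
Qed.

Lemma sum_blocks (R : nmodType) (T : finType) n (g : T -> 'I_n) (x : T -> R)
    (k : 'I_n) :
  \sum_(e | (g e <= k)%N) x e =
  \sum_(c < n | (c <= k)%N) \sum_(e | g e == c) x e.
Proof.
rewrite (partition_big g (fun c : 'I_n => (c <= k)%N)) //=.
apply: eq_bigr => c ck; apply: eq_bigl => e.
by case: eqP => [->|]; rewrite ?ck ?andbF.
Qed.

(* Labels each column by the first tight constraint whose prefix contains it. *)
Lemma block_label n m (S : nat -> nat) (tight : pred 'I_n) :
  {homo S : k k' / (k <= k')%N} ->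
  (forall j : 'I_m, exists2 k : 'I_n, tight k & (j < S k.+1)%N) ->
  exists g : 'I_m -> 'I_n, (forall j, tight (g j)) /\
    forall j k, tight k -> (g j <= k)%N = (j < S k.+1)%N.
Proof.
move=> S_homo cover.
have /choice[g gP] : forall j : 'I_m, exists c : 'I_n, tight c /\
    forall k, tight k -> (c <= k)%N = (j < S k.+1)%N.
  move=> j; have [k0 tk0 jk0] := cover j.
  have Pk0 : tight k0 && (j < S k0.+1)%N by rewrite tk0.
  case: (@arg_minnP _ k0 (fun k => tight k && (j < S k.+1)%N) val Pk0).
  move=> c /andP[tc jc] c_min; exists c; split=> // k tk.
  apply/idP/idP => [ck|jk]; last by apply: c_min; rewrite tk.
  exact: leq_trans jc (S_homo _ _ _).
by exists g; split=> [j|j k]; case: (gP j) => // _; apply.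
Qed.

(** Strong induction on [c]: the prefix sum up to [c] is block [c] plus earlier blocks, already
    integral. Labels outside [codom g] have empty blocks. *)
Lemma block_sum_int (R : archiNumDomainType) (T : finType) n (g : T -> 'I_n)
    (x : T -> R) (c : 'I_n) :
  (forall k, k \in codom g -> \sum_(e | (g e <= k)%N) x e \is a Num.int) ->
  \sum_(e | g e == c) x e \is a Num.int.
Proof.
move=> prefZ; have [k] := ubnP (val c).
elim: k c => // k IHk c; rewrite ltnS => ck.
have [cg|cg] := boolP (c \in codom g); last first.
  rewrite big_pred0 // => e; apply/eqP => ge.
  by rewrite -ge codom_f in cg.
have := prefZ c cg; rewrite sum_blocks (bigD1 c) //= rpredDr //.
apply: rpred_sum => c' /andP[c'c ne]; apply: IHk.
by rewrite (leq_trans _ ck) // ltn_neqAle c'c andbT.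
Qed.

(** Zero entries are integral, hence not edges and not moved; a tight prefix is a union of blocks,
    so [d] sums to 0 over it. *)
Lemma balanced_direction (R : archiRealFieldType) n m (S : nat -> nat)
    (x : 'M[R]_(n, m)) (e0 : 'I_n * 'I_m) :
  {homo S : k k' / (k <= k')%N} -> (m <= S n)%N ->
  (forall i, \sum_(j < m) x i j = 1) -> x e0.1 e0.2 \isn't a Num.int ->
  exists d : 'M[R]_(n, m), [/\ exists i j, d i j != 0,
    forall i j, x i j = 0 -> d i j = 0,
    forall i, \sum_(j < m) d i j = 0
    & forall k : 'I_n,
        \sum_(j < m | (j < S k.+1)%N) \sum_(i < n) x i j = k.+1%:R ->
        \sum_(j < m | (j < S k.+1)%N) \sum_(i < n) d i j = 0].
Proof.
move=> S_homo mS row1 e0Z.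
pose colsum (y : 'M[R]_(n, m)) (k : 'I_n) :=
  \sum_(j < m | (j < S k.+1)%N) \sum_(i < n) y i j.
pose tight k := colsum x k == k.+1%:R.
have n_gt0 : (0 < n)%N by apply: leq_ltn_trans (ltn_ord e0.1).
have pred_n : (n.-1 < n)%N by rewrite prednK.
have [|g [tight_g gP]] := @block_label n m S tight S_homo.
  (* The last constraint is always tight, since the row sums add up to [n], and its prefix contains
     every column. *)
  move=> j; exists (Ordinal pred_n); last first.
    by rewrite /= prednK // (leq_trans (ltn_ord j)).
  rewrite /tight /colsum /= prednK // (eq_bigl predT); last first.
    by move=> i; rewrite (leq_trans (ltn_ord i)).
  rewrite exchange_big /= (eq_bigr (fun=> 1)) => [|i _]; last exact: row1.
  by rewrite sumr_const card_ord.
have colsumE y k : tight k ->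
    colsum y k = \sum_(e : 'I_n * 'I_m | (g e.2 <= k)%N) y e.1 e.2.
  by move=> tk; rewrite /colsum sum_colE; apply: eq_bigl => e; rewrite gP.
pose F := [set e : 'I_n * 'I_m | x e.1 e.2 \isn't a Num.int]%SET.
have [|||d [[e de] dF d_row d_block]] :=
    @balanced_vector R _ _ _ F fst (fun e => g e.2) e0.
- by rewrite inE.
- move=> e; rewrite inE => eZ.
  have [||e' [e'Z ne ee']] := @sum_int_other _ _ (fun e' => e'.1 == e.1)
      (fun e => x e.1 e.2) e _ _ eZ => //.
    by rewrite -sum_rowE row1 rpred1.
  by exists e'; rewrite inE e'Z ne (eqP ee').
- move=> e; rewrite inE => eZ.
  have [||e' [e'Z ne ee']] := @sum_int_other _ _ (fun e' => g e'.2 == g e.2)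
      (fun e => x e.1 e.2) e _ _ eZ => //.
    (* Labels are tight, so their prefix sums are natural numbers. *)
    apply: block_sum_int => k /codomP[f ->].
    by rewrite -colsumE // (eqP (tight_g _)) rpred_nat.
  by exists e'; rewrite inE e'Z ne (eqP ee').
exists (\matrix_(i, j) d (i, j)); split.
- by exists e.1, e.2; rewrite mxE -surjective_pairing.
- by move=> i j xij; rewrite mxE dF // inE xij rpred0.
- move=> i; rewrite sum_rowE -[RHS](d_row i).
  by apply: eq_bigr => f _; rewrite mxE -surjective_pairing.
- move=> k /eqP tk; rewrite -/(colsum _ k) colsumE // sum_blocks big1 // => c _.
  rewrite -[RHS](d_block c).
  by apply: eq_bigr => f _; rewrite mxE -surjective_pairing.
Qed.

(** * Parking functions as the integral points *)

Section Parking.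
Context (R : realType) (n : nat) (b : 'I_n -> nat).
Local Notation m := (psum b n).

(** Trades sorting for counting, the form that the prefix constraints take on assignment
    matrices. *)
Lemma parking_functionE (beta : n.-tuple nat) :
  all (fun x => 0 < x)%N beta ->
  (forall k : 'I_n, k < count (fun x => x <= psum b k.+1)%N beta)%N <->
  parking_function b beta.
Proof.
move=> beta_gt0.
have sortE k : (k < n)%N -> (nth 0 (sort leq beta) k <= psum b k.+1)%N =
    (k < count (fun x => x <= psum b k.+1) beta)%N.
  move=> kn; rewrite sorted_nth_leq ?size_sort ?size_tuple //.
    by rewrite (permP (permEl (perm_sort _ _))).
  exact: (sort_sorted leq_total).
split=> [beta_le|[_ beta_le] k]; last by rewrite -sortE ?beta_le.
by split=> // k kn; rewrite sortE //; apply: (beta_le (Ordinal kn)).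
Qed.

Lemma parking_function_le (beta : n.-tuple nat) i :
  parking_function b beta -> (tnth beta i <= m)%N.
Proof.
move=> betaP; have [/parking_functionE/iffRL/(_ betaP) beta_le _] := betaP.
have n_gt0 : (0 < n)%N by apply: leq_ltn_trans (ltn_ord i).
have pred_n : (n.-1 < n)%N by rewrite prednK.
(* The last bound says that at least [n] entries, hence all, are at most [m]. *)
have := beta_le (Ordinal pred_n); rewrite /= prednK // => le_count.
have /allP : all (fun x => x <= m)%N beta.
  by rewrite all_count eqn_leq count_size size_tuple.
by apply; apply: mem_tnth.
Qed.

(** Value [j.+1] is recorded in the 0-based column [j]. *)
Definition assignment_mx (beta : n.-tuple nat) : 'M[R]_(n, m) :=
  \matrix_(i, j) (tnth beta i == j.+1)%:R.

(** Constant [f] gives row and prefix sums, and the cast [x%:R] gives weighted sums. *)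
Lemma sum_assignment (beta : n.-tuple nat) (i : 'I_n) (P : pred nat)
    (f : nat -> R) : (0 < tnth beta i <= m)%N ->
  \sum_(j < m | P j.+1) f j.+1 * assignment_mx beta i j =
  (P (tnth beta i))%:R * f (tnth beta i).
Proof.
move=> /andP[beta_gt0 beta_le].
have beta_lt : ((tnth beta i).-1 < m)%N by rewrite prednK.
rewrite big_mkcond (bigD1 (Ordinal beta_lt)) //= mxE /= prednK // eqxx mulr1.
rewrite big1 ?addr0; first by case: (P _); rewrite ?mul1r ?mul0r.
move=> j ne; rewrite mxE; case: eqP => [ij|]; last by rewrite mulr0 if_same.
by case/eqP: ne; apply/val_inj; rewrite /= ij.
Qed.

Lemma sum_assignment_prefix (beta : n.-tuple nat) (k : nat) :
  (forall i, 0 < tnth beta i <= m)%N ->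
  \sum_(j < m | (j < k)%N) \sum_(i < n) assignment_mx beta i j =
  (count (fun x => x <= k)%N beta)%:R.
Proof.
move=> beta_bd; rewrite exchange_big /=.
transitivity (\sum_(i < n) (tnth beta i <= k)%N%:R : R).
  apply: eq_bigr => i _.
  have := @sum_assignment beta i (fun x => x <= k)%N (fun=> 1) (beta_bd i).
  by rewrite mulr1 => <-; apply: eq_bigr => j _; rewrite mul1r.
rewrite -natr_sum; congr _%:R.
by rewrite -sum1_count big_tuple [RHS]big_mkcond; apply: eq_bigr => i _; case: leqP.
Qed.

Lemma weighted_assignment (beta : n.-tuple nat) :
  (forall i, 0 < tnth beta i <= m)%N ->
  weighted_row_sum (assignment_mx beta) = \row_i (tnth beta i)%:R.
Proof.
move=> beta_bd; apply/rowP => i; rewrite !mxE.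
have := @sum_assignment beta i predT (fun x => x%:R) (beta_bd i).
by rewrite mul1r.
Qed.

Lemma assignment_relaxed (beta : n.-tuple nat) :
  (forall i, 0 < tnth beta i <= m)%N ->
  relaxed_partition_polytope R b (assignment_mx beta) <->
  parking_function b beta.
Proof.
move=> beta_bd.
have beta_gt0 : all (fun x => 0 < x)%N beta.
  by apply/all_tnthP => i; case/andP: (beta_bd i).
rewrite -parking_functionE //; split=> [[_ xS _] k|beta_le].
  have := xS k.+1; rewrite ltn_ord sum_assignment_prefix // ler_nat.
  exact.
split=> [i|[|k] //= kn|i j].
- have := @sum_assignment beta i predT (fun=> 1) (beta_bd i).
  by rewrite mulr1; apply: etrans; apply: eq_bigr => j _; rewrite mul1r.
- by rewrite sum_assignment_prefix // ler_nat; apply: (beta_le (Ordinal kn)).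
- by rewrite mxE ler0n.
Qed.

(** Nonnegative integers with sum 1 are a single 1 and zeros, so row [i] selects one column [s i],
    and [beta] records it 1-based. *)
Lemma integral_relaxed (x : 'M[R]_(n, m)) :
  relaxed_partition_polytope R b x -> (forall i j, x i j \is a Num.int) ->
  exists2 beta, parking_function b beta & x = assignment_mx beta.
Proof.
move=> xP xZ; have [row1 _ x_ge0] := xP.
have /choice[s sP] : forall i, exists j : 'I_m, forall j', x i j' = (j' == j)%:R.
  move=> i; have [j xij] : exists j, x i j != 0.
    apply/existsP; apply: contraT; rewrite negb_exists => /forallP x0.
    have := row1 i; rewrite big1 => [/eqP|j _]; first by rewrite eq_sym oner_eq0.
    by apply/eqP; have := x0 j; rewrite negbK.
  have xij_ge1 : 1 <= x i j by rewrite -[x i j]ger0_norm // norm_intr_ge1.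
  have := row1 i; rewrite (bigD1 j) //= => sum1.
  have rest_ge0 : 0 <= \sum_(k < m | k != j) x i k by apply: sumr_ge0.
  have rest0 : \sum_(k < m | k != j) x i k = 0.
    apply/eqP; rewrite eq_le rest_ge0 andbT.
    by rewrite -(lerD2l (x i j)) sum1 addr0.
  exists j => k; case: eqP => [->|/eqP kj].
    by move: sum1; rewrite rest0 addr0.
  by rewrite (psumr_eq0P _ rest0).
pose beta : n.-tuple nat := [tuple (s i).+1 | i < n].
have beta_bd i : (0 < tnth beta i <= m)%N by rewrite tnth_mktuple /=.
have x_beta : x = assignment_mx beta.
  by apply/matrixP => i j; rewrite mxE tnth_mktuple sP eqSS eq_sym.
by exists beta => //; apply/assignment_relaxed; rewrite -?x_beta.
Qed.

(** Applies [polyhedron_ind] with entries ([inl]) and prefixes ([inr]) as inequalities and the row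
    sums as [E]. *)
Lemma relaxed_hull_ind (A : 'M[R]_(n, m) -> Prop) :
  (forall x y (t : R), 0 <= t <= 1 -> A x -> A y -> A (t *: x + (1 - t) *: y)) ->
  (forall beta, parking_function b beta -> A (assignment_mx beta)) ->
  forall x, relaxed_partition_polytope R b x -> A x.
Proof.
move=> convA A_beta x [row1 colS x_ge0].
pose l (c : 'I_n * 'I_m + 'I_n) (y : 'M[R]_(n, m)) : R :=
  match c with
  | inl e => y e.1 e.2
  | inr k => \sum_(j < m | (j < psum b k.+1)%N) \sum_(i < n) y i j
  end.
pose a (c : 'I_n * 'I_m + 'I_n) : R := if c is inr k then k.+1%:R else 0.
have relaxedP (y : 'M[R]_(n, m)) : (forall i, \sum_(j < m) y i j = 1) ->
    (forall c, a c <= l c y) -> relaxed_partition_polytope R b y.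
  move=> y1 y_ge; split=> // [[|k] //= kn|i j].
    exact: (y_ge (inr (Ordinal kn))).
  exact: (y_ge (inl (i, j))).
apply: (@polyhedron_ind R _ _ l a _ 
  (fun y : 'M[R]_(n, m) => forall i, \sum_(j < m) y i j = 1)
  A convA _ x row1).
- case=> [e|k] y t d /=; first by rewrite !mxE.
  rewrite mulr_sumr -big_split; apply: eq_bigr => j _ /=.
  by rewrite mulr_sumr -big_split; apply: eq_bigr => i _; rewrite !mxE.
- move=> {x row1 colS x_ge0} x row1 x_ge.
  have [/existsP[e xe]|intx] := boolP
      [exists e : 'I_n * 'I_m, x e.1 e.2 \isn't a Num.int]; last first.
    have xP := relaxedP x row1 x_ge.
    left; have [i j|beta betaP ->] := integral_relaxed xP; last exact: A_beta.
    move: intx; rewrite negb_exists => /forallP/(_ (i, j)).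
    by rewrite negbK.
  right; have [d [[i [j dij]] d_x d_row d_tight]] :=
    balanced_direction (@leq_psum n b) (leqnn m) row1 xe.
  exists d; split.
  + move=> t k; under eq_bigr do rewrite !mxE.
    by rewrite big_split /= -mulr_sumr d_row mulr0 addr0.
  + by case=> [f|k] /=; [apply: d_x|apply: d_tight].
  (* A nonzero row of [d] with sum 0 has entries of both signs, so some sign constraint decreases
     along [d] and another increases. *)
  + have [k dk] := sum_eq0_lt0 (d_row i) isT dij.
    by exists (inl (i, k)).
  + have := d_row i; move/(congr1 -%R); rewrite oppr0 -sumrN => dN_row.
    have [|k dk] := @sum_eq0_lt0 _ _ predT (fun j => - d i j) j dN_row isT.
      by rewrite oppr_eq0.
    by exists (inl (i, k)); rewrite /= -oppr_lt0.
- by case=> [e|k] /=; [apply: x_ge0|apply: colS; rewrite ltn_ord].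
Qed.

End Parking.

(** * Convex hulls and the two inclusions *)

Section MathcompConvexity.
Context (R : realType) (E : lmodType R).

Lemma convex_setE (A : set E) : @convex_set R E A <->
  (forall x y (t : R), 0 <= t <= 1 -> A x -> A y -> A (t *: x + (1 - t) *: y)).
Proof.
split=> convA x y t => [/andP[t0 t1] xA yA|/set_mem xA /set_mem yA].
  apply/set_mem; exact: (convA x y (Itv01 t0 t1) (mem_set xA) (mem_set yA)).
by apply/mem_set/convA => //; rewrite ge0 le1.
Qed.

Lemma convex_hull_convex (A : set E) : @convex_set R E (convex_hull A).
Proof.
apply/convex_setE => x y t t01 xA yA C [convC AC].
by move/convex_setE : (convC); apply=> //; [apply: xA|apply: yA].
Qed.

End MathcompConvexity.

Theorem corollary5p2 (R : realType) (n : nat) (b : 'I_n -> nat)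
    (n_gt0 : (0 < n)%N) (b_gt0 : forall i, (0 < b i)%N)
    (not_trivial : ~ (n = 1%N /\ forall i, b i = 1%N)) :
  parking_polytope R b =
  (@weighted_row_sum R n (psum b n)
     : {linear 'M[R]_(n, psum b n) -> 'rV[R]_n})
    @` relaxed_partition_polytope R b.
Proof.
have beta_bd beta : parking_function b beta ->
    forall i, (0 < tnth beta i <= psum b n)%N.
  move=> betaP i; rewrite parking_function_le // andbT.
  by case: betaP => /all_tnthP.
apply/seteqP; split=> [|_ [x xR <-]].
  (* The image is convex and contains every parking function, so it contains their hull. *)
  apply: smallest_sub.
    apply/convex_setE => _ _ t /andP[t0 t1] [x [x1 xS x0] <-] [y [y1 yS y0] <-].
    rewrite -!linearZ -linearD; exists (t *: x + (1 - t) *: y) => //.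
    have conv1 (c : R) : c = t * c + (1 - t) * c by rewrite -mulrDl subrKC mul1r.
    split=> [i|k kn|i j].
    - under eq_bigr do rewrite !mxE.
      by rewrite big_split /= -!mulr_sumr x1 y1 -conv1.
    - under eq_bigr do under eq_bigr do rewrite !mxE.
      under eq_bigr do rewrite big_split /= -!mulr_sumr.
      rewrite big_split /= -!mulr_sumr [leLHS]conv1.
      by rewrite lerD // ler_wpM2l ?subr_ge0 ?xS ?yS.
    - by rewrite !mxE addr_ge0 ?mulr_ge0 ?subr_ge0.
  move=> _ [beta /= betaP <-]; exists (assignment_mx R b beta).
    by apply/assignment_relaxed; [apply: beta_bd|].
  exact/weighted_assignment/beta_bd.
(* The preimage of the parking polytope is convex and contains the assignment matrices. *)
move: x xR; apply: (@relaxed_hull_ind R n b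
  (fun x => parking_polytope R b (weighted_row_sum x))) => [x y t t01 xA yA|beta betaP].
  rewrite linearD !linearZ_LR.
  exact: (proj1 (convex_setE _) (@convex_hull_convex R _ _)).
rewrite weighted_assignment; last exact: beta_bd.
by apply: sub_gen_smallest; exists beta.
Qed.
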